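(* Let $(\mathcal{X}, d)$ be a metric space. Then every sequentially tight sequence $(\mu_n)_{n\in\mathbb{N}}$ in $\mathcal{M}_1(\mathcal{X})$ is precompact.
   Context: $\mathcal{M}_1(\mathcal{X})$ denotes the set of Borel probability measures on $\mathcal{X}$, equipped with the topology of weak convergence; $\mu_n \to \mu$ weakly means $\int f\,\mathrm{d}\mu_n \to \int f\,\mathrm{d}\mu$ for every bounded continuous $f:\mathcal{X}\to\mathbb{R}$. A sequence in $\mathcal{M}_1(\mathcal{X})$ is called precompact if every subsequence of it has a further subsequence converging weakly to some element of $\mathcal{M}_1(\mathcal{X})$. For $x\in\mathcal{X}$, $A\subset\mathcal{X}$ and $\delta>0$ write $B_x(\delta)=\{y\in\mathcal{X} : d(x,y)<\delta\}$ and $B_A(\delta)=\bigcup_{x\in A}B_x(\delta)$. Sequential tightness: a sequence $(\mu_n)_{n\in\mathbb{N}}$ in $\mathcal{M}_1(\mathcal{X})$ is sequentially tight if for each $\varepsilon>0$ there exists a collection of compact subsets $(K_\varepsilon^\delta)_{\delta>0}$ of $\mathcal{X}$ such that (i) $\liminf_{n\to\infty}\mu_n\big(B_{K_\varepsilon^\delta}(\delta)\big)\ge 1-\varepsilon$ for every $\varepsilon,\delta>0$, and (ii) for every $\varepsilon>0$ the subspace $K_\varepsilon:=\overline{\bigcup_{\delta>0}K_\varepsilon^\delta}\subset\mathcal{X}$ is complete. *)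

(* Defs.v *)
From HB Require Import structures.
From mathcomp Require Import all_boot all_order all_algebra.
From mathcomp Require Import all_classical all_reals all_analysis.
Import numFieldNormedType.Exports.

Set Implicit Arguments.
Unset Strict Implicit.
Unset Printing Implicit Defensive.

Import Order.TTheory GRing.Theory Num.Theory.

Local Open Scope classical_set_scope.
Local Open Scope ring_scope.

(* A [measurableType] is pointed, so the Borel sigma-algebra can only be put on
   a metric space with a chosen point.  The point is otherwise irrelevant, and
   only the empty space, which carries no probability measure, is excluded. *)
#[short(type="pointedMetricType")]
HB.structure Definition PointedMetric (K : numDomainType) :=
  {M of Metric K M & isPointed M}.

Notation borel X := (g_sigma_algebraType (@open X)).

Section definitions.
Context {R : realType} {X : pointedMetricType R}.

(* [ball x delta] is [[set y | mdist x y < delta]], see [ballEmdist]. *)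
Definition neighborhood (A : set X) (delta : R) : set X :=
  \bigcup_(x in A) ball x delta.

Definition complete_subspace (A : set X) : Prop :=
  forall u : nat -> X, (forall n, A (u n)) -> cauchy (u @ \oo) ->
  exists2 x, A x & u @ \oo --> x.

Definition sequentially_tight (mu : nat -> probability (borel X) R) : Prop :=
  forall eps : R, 0 < eps ->
  exists K : R -> set X,
    [/\ forall delta, 0 < delta -> compact (K delta),
        forall delta, 0 < delta ->
          ((1 - eps)%:E <=
             limn_einf (fun n => mu n (neighborhood (K delta) delta)))%E
      & complete_subspace
          (closure (\bigcup_(delta in [set delta | 0 < delta]) K delta))].

Definition weakly_converges (mu : nat -> probability (borel X) R)
    (nu : probability (borel X) R) : Prop :=
  forall f : X -> R, continuous f -> bounded_fun f ->
  \int[mu n]_x f x @[n --> \oo] --> \int[nu]_x f x.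

Definition precompact_seq (mu : nat -> probability (borel X) R) : Prop :=
  forall phi : nat -> nat, increasing_seq phi ->
  exists psi : nat -> nat, increasing_seq psi /\
  exists nu : probability (borel X) R,
    weakly_converges (fun n => mu (phi (psi n))) nu.

End definitions.

(* Main.v *)
(* Fix, for all integers m and l, finitely many balls of radius 1/(l+1), centred
   in the union A_m of the compact sets attached to eps = 1/(m+2), that carry
   mass at least 1 - 1/(m+1) for mu_n with n large.  Enumerate all these balls as
   B_0, B_1, ... and record for each point the digits [x in B_j].  The first k
   digits take finitely many values, so along a diagonal subsequence their laws
   converge for every k; the limits are consistent and are the law of a random
   branch of the binary tree, realised on [0, 1) with Lebesgue measure.  By
   Fatou, for almost every branch there is an m such that its (nested, nonempty)
   cells lie in balls of radius 1/(l+1) centred in A_m for infinitely many l, so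
   by completeness of the closure of A_m they shrink to a point of the space.
   The law of that point is the weak limit. *)
Require Import Defs.
From HB Require Import structures.
From mathcomp Require Import all_boot all_order all_algebra.
From mathcomp Require Import all_classical all_reals all_analysis.
From mathcomp Require Import measurable_realfun lra.
Import numFieldNormedType.Exports.
Set Implicit Arguments.
Unset Strict Implicit.
Unset Printing Implicit Defensive.
Import Order.TTheory GRing.Theory Num.Theory.
Local Open Scope classical_set_scope.
Local Open Scope ring_scope.

(** * Diagonal extraction, and a random branch with prescribed node weights *)

(** By Tychonoff, [M] has a cluster point in the cube of functions from [T] to [0, 1]. As [T] is
    countable, controlling one more coordinate at each stage yields pointwise convergence. *)
Lemma diagonal_subsequence (R : realType) (T : countType) (M : nat -> T -> R) :
  (forall n s, 0 <= M n s <= 1) ->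
  exists2 psi : nat -> nat, increasing_seq psi &
    exists p : T -> R, forall s, M (psi n) s @[n --> \oo] --> p s.
Proof.
move=> M01.
have /= [p [_ clp]] : exists p : T -> R,
    ([set f | forall s, f s \in `[0, 1]%R] `&`
      @cluster (prod_topology (fun _ : T => R)) (M @ \oo)) p.
  apply: (@tychonoff T (fun=> R) (fun=> [set` `[0, 1]%R])).
    by move=> _; exact: segment_compact.
  by exists 0%N => // n _ s; rewrite /= in_itv/= M01.
have pB k e : 0 < e -> nbhs (p : prod_topology (fun _ : T => R))
    [set q : T -> R | forall s, (pickle s < k)%N -> `|p s - q s| < e].
  move=> e0; elim: k => [|k IH].
    exact: (@filterE _ _ (nbhs_filter (p : prod_topology _))).
  have pk : nbhs (p : prod_topology (fun _ : T => R)) [set q : T -> R |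
      if unpickle k is Some s then `|p s - q s| < e else True].
    case: (unpickle k) => [s|].
      apply: (@proj_continuous T (fun=> R) s p (ball (p s) e)).
      exact: nbhsx_ballx.
    exact: (@filterE _ _ (nbhs_filter (p : prod_topology _))).
  apply: (@filterS2 _ _ (nbhs_filter (p : prod_topology _)) _ _ _ _ IH pk).
  move=> q {}IH qk s; rewrite ltnS leq_eqVlt => /orP[/eqP sk|].
    by move: qk; rewrite -sk pickleK.
  exact: IH.
have step k N : {n | (N < n)%N /\
    forall s, (pickle s < k)%N -> `|p s - M n s| < k.+1%:R^-1}.
  apply: cid.
  have FA : (M @ \oo) (M @` [set n | (N < n)%N]).
    by exists N.+1 => // n /= Nn; exists n.
  have [|_ [[n /= Nn <-] Bn]] := clp _ _ FA (pB k k.+1%:R^-1 _).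
    by rewrite invr_gt0.
  by exists n.
(* A state pairs a stage with the index chosen last; each move brings the coordinates with code
   below the stage close to [p]. *)
pose S (a b : nat * nat) := [/\ b.1 = a.1.+1, (a.2 < b.2)%N &
    forall s, (pickle s < a.1)%N -> `|p s - M b.2 s| < a.1.+1%:R^-1].
have [|psi [psi0 psiS]] := @dependent_choice _ S _ (0%N, 0%N).
  by move=> [k N]; have [n [Nn nk]] := step k N; exists (k.+1, n); split.
(* The shift by one skips the seed [(0, 0)], which was not chosen by [step]. *)
exists (fun n => (psi n.+1).2).
  by apply/increasing_seqP => n; have [] := psiS n.+1.
exists p => s.
have psi1 n : (psi n).1 = n.
  by elim: n => [|n IH]; [rewrite psi0|have [-> _ _] := psiS n; rewrite IH].
apply/cvgrPdist_lt => e e0; near=> n.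
have [_ _ /(_ s)] := psiS n; rewrite psi1 => /(_ _)/lt_trans; apply.
  by near: n; exact: nbhs_infty_gt.
by near: n; exact: (near_infty_natSinv_lt (PosNum e0)).
Unshelve. all: by end_near. Qed.

(* Nodes of the binary tree are written with the most recent digit first. *)
Lemma tree_probability (R : realType) (p : seq bool -> R) :
  (forall s, 0 <= p s) -> p [::] = 1 ->
  (forall s, p s = p (false :: s) + p (true :: s)) ->
  exists (d : measure_display) (Omega : measurableType d)
    (P : probability Omega R) (path : Omega -> nat -> seq bool),
    [/\ forall t, path t 0%N = [::],
        forall t k, exists b, path t k.+1 = b :: path t k,
        forall t k, 0 < p (path t k) &
        forall s, measurable [set t | path t (size s) = s] /\
          P [set t | path t (size s) = s] = (p s)%:E].
Proof.
move=> p0 p1 pD.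
have [P PE] : exists P : probability (g_sigma_algebraType R.-ocitv.-measurable) R,
    forall b c : R, 0 <= b -> c <= 1 -> b <= c ->
    P [set` `[b, c[%R] = (c - b)%:E.
  exists (uniform_prob (@ltr01 R)) => b c b0 c1 bc /=; rewrite /uniform_prob.
  rewrite (eq_integral (fun=> 1%:E)); last first.
    move=> x; rewrite inE /= in_itv /= => /andP[bx xc].
    rewrite /uniform_pdf (le_trans b0 bx) (ltW (lt_le_trans xc c1)).
    by rewrite subr0 invr1.
  rewrite integral_cst//= mul1e lebesgue_measure_itv /= lte_fin.
  by case: ltgtP bc => // ->; rewrite subrr.
(* The node [s] is sent to the interval [[a s, a s + p s)], its two children
   splitting it; a branch is followed by locating the point in these. *)
pose a := fix a (s : seq bool) : R :=
  if s is b :: s' then a s' + (if b then p (false :: s') else 0) else 0.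
pose path0 := fix path0 (t : R) k : seq bool :=
  if k is k'.+1 then
    let s := path0 t k' in (a s + p (false :: s) <= t) :: s
  else [::].
have size0 t k : size (path0 t k) = k by elim: k => //= k ->.
have path0P (s : seq bool) t : 0 <= t < 1 ->
    path0 t (size s) = s <-> a s <= t < a s + p s.
  move=> t01; elim: s => [|b s IH]; first by rewrite /= p1 add0r.
  rewrite /=; split.
    move=> [bE /[dup] /IH /andP[ast tas] sE]; rewrite sE in bE.
    move: bE; case: b => [->|/negbT]; rewrite -?ltNge.
      by rewrite -addrA -pD.
    by rewrite addr0 ast => ->.
  move=> H; have /IH sE : a s <= t < a s + p s.
    move: H; rewrite (pD s); have := p0 (true :: s); have := p0 (false :: s).
    by case: b; lra.
  rewrite sE; congr (_ :: _).
  case: b H => /andP[H1 H2]; first by rewrite H1.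
  by apply/negbTE; rewrite -ltNge -[a s]addr0.
have as01 s : 0 <= a s /\ a s + p s <= 1.
  elim: s => [|b s [IH1 IH2]]; first by rewrite /= p1 add0r lexx.
  rewrite /=; move: IH2; rewrite (pD s).
  have := p0 (true :: s); have := p0 (false :: s).
  by case: b; split; lra.
(* The sample space is the whole line; points outside [0, 1), a null set, follow the branch of 0. *)
pose clamp (t : R) : R := if (0 <= t) && (t < 1) then t else 0.
have clamp01 t : 0 <= clamp t < 1.
  by rewrite /clamp; case: ifP => // _; rewrite lexx ltr01.
exists _, _, P, (path0 \o clamp); split => //=.
- by move=> t k; eexists.
(* A point lies in the half-open interval of each node it visits, so nodes of weight 0 are avoided
   surely, not only almost surely. *)
- move=> t k.
  have := (path0P (path0 (clamp t) k) (clamp t) (clamp01 t)).1.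
  by rewrite size0 => /(_ erefl)/andP[/le_lt_trans]/[apply]; rewrite ltrDl.
move=> s.
pose I : set R := `[0, 1[%classic.
have clampI t : I t -> clamp t = t.
  by rewrite /I /clamp /= in_itv /= => ->.
have clampNI t : ~ I t -> clamp t = 0.
  by rewrite /I /clamp /= in_itv /= => /negP/negbTE ->.
have sub01 t : a s <= t < a s + p s -> I t.
  have [/le_trans a0 /(lt_le_trans _) ap1] := as01 s.
  by move=> /andP[/a0 + /ap1]; rewrite /I /= in_itv /= => -> ->.
set F := [set t | _].
have FI : F `&` I = `[a s, a s + p s[%classic.
  apply/seteqP; split => t /=; rewrite in_itv /=.
    move=> [Ft It]; apply/path0P; last by rewrite /F /= clampI in Ft.
    by rewrite /I /= in_itv in It.
  move=> H; have It := sub01 _ H; split=> //; rewrite /F /= clampI//.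
  by apply/path0P => //; move: It; rewrite /I /= in_itv.
(* Outside [I] every branch is that of 0, so this part of [F] is all or nothing. *)
have FNI : F `\` I = if path0 0 (size s) == s then ~` I else set0.
  apply/seteqP; split => t /=.
    by move=> [Ft It]; rewrite /F /= clampNI// in Ft; rewrite Ft eqxx.
  by case: eqP => // sE It; split=> //; rewrite /F /= clampNI.
have mF : measurable F.
  rewrite -(setUIDK F I) FI FNI; apply: measurableU; first exact: measurable_itv.
  case: ifP => _; last exact: measurable0.
  by apply: measurableC; exact: measurable_itv.
split => //.
have mI : measurable I by exact: measurable_itv.
rewrite -(setUIDK F I) measureU; last first.
- by rewrite setDE setIACA setICr setI0.
- exact: measurableD.
- exact: measurableI.
have [a0 ap1] := as01 s.
rewrite -[RHS]adde0; congr (_ + _)%E.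
  rewrite FI; apply: eq_trans (PE _ _ a0 ap1 _) _; first by rewrite lerDl.
  by rewrite addrAC subrr add0r.
apply: (@subset_measure0 _ _ _ P _ (~` I)) => //.
- exact: measurableD.
- exact: measurableC.
have PI : P I = 1%E by apply: eq_trans (PE _ _ _ _ _) _; rewrite ?subr0.
by apply: eq_trans (probability_setC P mI) _; rewrite PI subee.
Qed.

(** * Limit points of shrinking nested sets *)

(** Any two of the chosen small balls contain a common nonempty [C k], so their centres form a
    Cauchy sequence in [A]; its limit is the point sought. *)
Lemma complete_subspace_shrinking (R : realType) (X : pointedMetricType R)
    (A : set X) (C : nat -> set X) :
  complete_subspace (closure A) ->
  (forall k, C k !=set0) ->
  (forall m n, (m <= n)%N -> C n `<=` C m) ->
  (forall e, 0 < e -> exists k, exists2 q, A q & C k `<=` ball q e) ->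
  exists x, forall e, 0 < e -> exists k, C k `<=` ball x e.
Proof.
move=> complA C0 Cmono CA.
have /choice[kq kqP] : forall n : nat, exists kq : nat * X,
    A kq.2 /\ C kq.1 `<=` ball kq.2 n.+1%:R^-1.
  move=> n; have [|k [q Aq Cq]] := CA n.+1%:R^-1; first by rewrite invr_gt0.
  by exists (k, q).
have small e : 0 < e -> \forall n \near \oo, (n.+1%:R^-1 : R) < e.
  by move=> e0; exact: (near_infty_natSinv_lt (PosNum e0)).
have [||x _ xlim] := complA (fun n => (kq n).2).
- by move=> n; apply: subset_closure; have [] := kqP n.
- apply: cauchy_exP => e e0.
  have [N _ NP] := small (e / 2) (divr_gt0 e0 (ltr0Sn _ 1)).
  exists (kq N).2, N => // n /= Nn.
  have [y Cy] := C0 (maxn (kq N).1 (kq n).1).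
  have [_ /(_ y (Cmono _ _ (leq_maxl _ _) _ Cy)) yN] := kqP N.
  have [_ /(_ y (Cmono _ _ (leq_maxr _ _) _ Cy)) /ball_sym yn] := kqP n.
  rewrite (splitr e); apply: (ball_triangle (y := y)).
    by apply: le_ball yN; exact/ltW/NP/leqnn.
  by apply: le_ball yn; exact/ltW/NP.
exists x => e e0.
have [n [qn en]] : exists n, ball x (e / 2) (kq n).2 /\ n.+1%:R^-1 < e / 2.
  have := cvg_ball xlim (divr_gt0 e0 (ltr0Sn _ 1)).
  move=> /(_ _)/filterI /(_ (small (e / 2) (divr_gt0 e0 (ltr0Sn _ 1)))).
  by move=> [n _ /(_ n (leqnn n))]; exists n.
exists (kq n).1 => y /(kqP n).2 yq.
rewrite (splitr e); apply: (ball_triangle (y := (kq n).2)) => //.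
by apply: le_ball yq; exact: ltW.
Qed.

(** * Countably valued maps and bounded integrands *)

Section finite_valued.
Context d (T : measurableType d) (R : realType) (P : probability T R).
Context (I : countType) (g : T -> I).
Hypothesis mg : forall i, measurable (g @^-1` [set i]).

Lemma measurable_countable_preimage (Q : set I) : measurable (g @^-1` Q).
Proof.
rewrite (_ : _ @^-1` _ =
    \bigcup_i if `[< Q i >] then g @^-1` [set i] else set0).
  apply: countable_bigcupT_measurable => // i.
  by case: ifP => // _; exact: measurable0.
apply/seteqP; split => t /=.
  by move=> Qt; exists (g t) => //; rewrite asboolT.
by move=> [i _]; case: asboolP => // Qi ->.
Qed.

Lemma measurable_countable_comp (h : I -> R) : measurable_fun setT (h \o g).
Proof.
move=> _ Y mY; rewrite setTI; exact: (measurable_countable_preimage (h @^-1` Y)).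
Qed.

Lemma Rintegral_finite (s : seq I) (h : I -> R) :
  uniq s -> (forall t, g t \in s) ->
  \int[P]_t h (g t) = \sum_(i <- s) h i * fine (P (g @^-1` [set i])).
Proof.
move=> us gs.
have hE t : (h (g t))%:E = (\sum_(i <- s) (h i * \1_(g @^-1` [set i]) t)%:E)%E.
  rewrite (bigD1_seq (g t))//= big1 ?adde0 => [|i /eqP gi].
    by rewrite indicE mem_set ?mulr1.
  by rewrite indicE memNset ?mulr0// => /esym.
have int_indic i : P.-integrable setT (EFin \o \1_(g @^-1` [set i]) : T -> \bar R).
  by apply: integrable_indic.
rewrite /Rintegral; under eq_integral do rewrite hE.
rewrite integral_sum//=; last first.
  move=> i; under eq_fun do rewrite EFinM.
  by apply: integrableZl => //; exact: int_indic.
rewrite -[RHS]/(fine _%:E) -sumEFin; congr fine; apply: eq_bigr => i _.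
under eq_integral do rewrite EFinM.
rewrite integralZl//; last exact: int_indic.
by rewrite integral_indic// setIT EFinM fineK ?fin_num_measure.
Qed.

End finite_valued.

Lemma bounded_integrable d (T : measurableType d) (R : realType)
    (P : probability T R) (f : T -> R) (M : R) :
  measurable_fun setT f -> (forall t, `|f t| <= M) ->
  P.-integrable setT (EFin \o f).
Proof.
move=> mf fM; apply: measurable_bounded_integrable => //.
  exact: le_lt_trans (probability_le1 P measurableT) (ltry 1).
exists M; split; first exact: num_real.
by move=> N MN t _; exact: le_trans (fM t) (ltW MN).
Qed.

Lemma Rintegral_bounded_cvg d (T : measurableType d) (R : realType)
    (P : probability T R) (f_ : nat -> T -> R) (f : T -> R) (M : R) :
  (forall k, measurable_fun setT (f_ k)) -> measurable_fun setT f ->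
  (forall k t, `|f_ k t| <= M) ->
  {ae P, forall t, f_ k t @[k --> \oo] --> f t} ->
  \int[P]_t f_ k t @[k --> \oo] --> \int[P]_t f t.
Proof.
move=> mf_ mf fM ff.
have [|||||intf _ lim] := @dominated_convergence _ _ _ P setT measurableT
    (fun k t => (f_ k t)%:E) (EFin \o f) (cst M%:E).
- by move=> k; exact/measurable_EFinP.
- exact/measurable_EFinP.
- by apply: filterS ff => t ft _; apply/fine_cvgP; split; [exact: nearW|exact: ft].
- exact: finite_measure_integrable_cst.
- by apply: nearW => t k _; rewrite /= lee_fin.
apply: fine_cvg; rewrite fineK//.
by apply: integrable_fin_num.
Qed.

(** * Itineraries and the cells they cut out *)

(* The itinerary lists membership in [B 0, ..., B (k - 1)], most recent first. *)
Fixpoint itinerary (X : Type) (B : nat -> set X) (x : X) (k : nat) : seq bool :=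
  if k is k'.+1 then `[< B k' x >] :: itinerary B x k' else [::].

(** The nonempty cells of sequences of length [k] are the atoms of the algebra generated by the
    first [k] sets [B j]. *)
Definition cell (X : Type) (B : nat -> set X) (s : seq bool) : set X :=
  [set x | itinerary B x (size s) = s].

Section cells.
Context (X : Type) (B : nat -> set X).

Lemma size_itinerary x k : size (itinerary B x k) = k.
Proof. by elim: k => //= k ->. Qed.

Lemma cell_itinerary x k : cell B (itinerary B x k) x.
Proof. by rewrite /cell /= size_itinerary. Qed.

Lemma cell_cons b s : cell B (b :: s) =
  cell B s `&` (if b then B (size s) else ~` B (size s)).
Proof.
apply/seteqP; split=> x; rewrite /cell /=.
  by move=> [<- ->]; split=> //; case: asboolP.
move=> [-> Bx]; congr (_ :: _).
by case: b Bx; [move=> ?; rewrite asboolT|move=> ?; rewrite asboolF].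
Qed.

(** Beyond depth [j] the itinerary contains the digit of [B j], so all points of the cell agree with
    [x] on it. *)
Lemma cell_itinerary_sub x k j : (j < k)%N -> B j x ->
  cell B (itinerary B x k) `<=` B j.
Proof.
elim: k => // k IH; rewrite ltnS leq_eqVlt cell_cons size_itinerary.
move=> /orP[/eqP-> Bx|jk Bx] y [ky]; first by rewrite asboolT.
by move=> _; exact: IH ky.
Qed.

Lemma fiber_itinerary k s : (itinerary B ^~ k) @^-1` [set s] =
  if size s == k then cell B s else set0.
Proof.
apply/seteqP; split=> x /=.
  by move=> <-; rewrite size_itinerary eqxx; exact: cell_itinerary.
by case: eqP => // <-.
Qed.

End cells.

Section measurable_cells.
Context d (T : measurableType d) (B : nat -> set T).
Hypothesis mB : forall j, measurable (B j).

Lemma measurable_cell s : measurable (cell B s).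
Proof.
elim: s => [|b s IH]; first by rewrite (_ : cell B [::] = setT)//; apply/seteqP.
by rewrite cell_cons; apply: measurableI => //; case: b => //; exact: measurableC.
Qed.

Lemma measurable_fiber_itinerary k s :
  measurable ((itinerary B ^~ k) @^-1` [set s]).
Proof. by rewrite fiber_itinerary; case: ifP => // _; exact: measurable_cell. Qed.

(** In the limit this becomes the consistency along the tree that [tree_probability] asks for. *)
Lemma probability_cell_split (R : realType) (P : probability T R) s :
  P (cell B s) = (P (cell B (false :: s)) + P (cell B (true :: s)))%E.
Proof.
rewrite !cell_cons /= addeC -measureU.
- by rewrite -setIUr setUv setIT.
- by apply: measurableI => //; exact: measurable_cell.
- by apply: measurableI; [exact: measurable_cell|exact: measurableC].
- by rewrite setIACA setICr setI0.
Qed.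

End measurable_cells.

(** * The limit law and the convergence towards it *)

Lemma continuous_measurable_borel (R : realType) (X : pointedMetricType R)
    (f : X -> R) :
  continuous f -> measurable_fun setT (f : borel X -> R).
Proof.
move=> cf; apply: (measurability _ (RGenOInfty.measurableE R)).
move=> _ [_ [a ->] <-]; rewrite setTI; apply: sub_sigma_algebra.
by move/continuousP : cf; apply; exact: rray_open.
Qed.

(* [path] is a random branch of the binary tree of cells, whose law is the
   limit [p] of the laws of the itineraries under [mu n]. *)
Section limit_law.
Context (R : realType) (X : pointedMetricType R) (B : nat -> set X).
Hypothesis oB : forall j, open (B j).
Context (mu : nat -> probability (borel X) R) (p : seq bool -> R).
Hypothesis mup : forall s, fine (mu n (cell B s)) @[n --> \oo] --> p s.
Context d (Omega : measurableType d) (P : probability Omega R)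
  (path : Omega -> nat -> seq bool).
Hypothesis path0 : forall t, path t 0%N = [::].
Hypothesis pathS : forall t k, exists b, path t k.+1 = b :: path t k.
Hypothesis p_path : forall t k, 0 < p (path t k).
Hypothesis mpath : forall s, measurable [set t | path t (size s) = s].
Hypothesis P_path : forall s, P [set t | path t (size s) = s] = (p s)%:E.

Let mB j : measurable (B j : set (borel X)).
Proof. by apply: sub_sigma_algebra; exact: oB. Qed.

Let size_path t k : size (path t k) = k.
Proof.
elim: k => [|k IH]; first by rewrite path0.
by have [b ->] := pathS t k; rewrite /= IH.
Qed.

Let fiber_path k s : (path ^~ k) @^-1` [set s] =
  if size s == k then [set t | path t (size s) = s] else set0.
Proof.
apply/seteqP; split=> t /=; first by move=> <-; rewrite size_path eqxx.
by case: eqP => // <-.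
Qed.

Lemma measurable_fiber_path k s : measurable ((path ^~ k) @^-1` [set s]).
Proof. by rewrite fiber_path; case: ifP => // _; exact: mpath. Qed.

(** An empty cell has mass 0 under every [mu n], hence limit weight 0, and [p_path] keeps the branch
    off such nodes. *)
Lemma cell_path_neq0 t k : cell B (path t k) !=set0.
Proof.
apply/set0P/eqP => C0; have := p_path t k.
suff -> : p (path t k) = 0 by rewrite ltxx.
have /cvg_lim <- := @mup (path t k); last exact: norm_hausdorff.
by under eq_fun do rewrite C0 measure0; exact: lim_cst.
Qed.

Lemma cell_path_mono t m n : (m <= n)%N ->
  cell B (path t n) `<=` cell B (path t m).
Proof.
move/subnK <-; elim: (n - m)%N => // k IH; rewrite addSn.
by have [b ->] := pathS t (k + m); rewrite cell_cons => x [/IH].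
Qed.

(** At a fixed depth both integrals are finite sums over the sequences of length [k], and the
    weights converge by [mup]. *)
Lemma Rintegral_itinerary_cvg (h : seq bool -> R) k :
  \int[mu n]_x h (itinerary B x k) @[n --> \oo] --> \int[P]_t h (path t k).
Proof.
pose S := [seq (s : seq bool) | s : k.-tuple bool].
have uS : uniq S by rewrite map_inj_uniq ?enum_uniq//; exact: val_inj.
have SP s : size s = k -> s \in S.
  by move=> sk; apply/mapP; exists (tcast sk (in_tuple s));
    rewrite ?mem_enum// val_tcast.
rewrite (Rintegral_finite P (measurable_fiber_path k) h uS); last first.
  by move=> t; exact/SP/size_path.
under eq_fun => n.
  rewrite (Rintegral_finite (mu n) (measurable_fiber_itinerary mB k) h uS);
    last by move=> x; exact/SP/size_itinerary.
  over.
apply: cvg_big => [|s _]; first exact: add_continuous.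
apply: cvgMl_tmp; rewrite fiber_path.
under eq_fun do rewrite fiber_itinerary.
case: ifP => _; first by rewrite P_path; exact: mup.
by rewrite measure0; under eq_fun do rewrite measure0; exact: cvg_cst.
Qed.

(** Taking the indicator of [Q] as integrand transfers mass bounds from [mu n] to [P]. *)
Lemma probability_itinerary_cvg (Q : set (seq bool)) k :
  fine (mu n [set x | Q (itinerary B x k)]) @[n --> \oo] -->
    fine (P [set t | Q (path t k)]).
Proof.
have RE d' (T : measurableType d') (nu : probability T R) (g : T -> seq bool) :
    (forall s, measurable (g @^-1` [set s])) ->
    \int[nu]_x \1_Q (g x) = fine (nu [set x | Q (g x)]).
  move=> mg; rewrite /Rintegral -[in RHS](setIT [set x | Q (g x)]).
  rewrite -integral_indic//; exact: measurable_countable_preimage.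
rewrite -RE; last exact: measurable_fiber_path.
under eq_fun do rewrite -(RE _ _ _ _ (measurable_fiber_itinerary mB k)).
exact: Rintegral_itinerary_cvg.
Qed.

Lemma measurable_path k (Q : set (seq bool)) : measurable [set t | Q (path t k)].
Proof. exact: (measurable_countable_preimage (measurable_fiber_path k) Q). Qed.

(* For a branch in [\bigcup_m lim_sup_set (F m)] the cells are infinitely often
   contained in small balls centred in a set with complete closure. *)
Lemma good_event (A : nat -> set X) (N : nat -> nat -> nat) :
  (forall m, complete_subspace (closure (A m))) ->
  (forall m l, \forall n \near \oo, 1 - m.+1%:R^-1 <=
    fine (mu n [set x | exists2 q, A m q &
      cell B (itinerary B x (N m l)) `<=` ball q l.+1%:R^-1])) ->
  exists G : set Omega, [/\ measurable G, P G = 1%E &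
    forall t, G t -> exists x, forall e, 0 < e ->
      exists k, cell B (path t k) `<=` ball x e].
Proof.
move=> complA tight.
pose W m l : set (seq bool) :=
  [set s | exists2 q, A m q & cell B s `<=` ball q l.+1%:R^-1].
pose F m l := [set t | W m l (path t (N m l))].
have mF m l : measurable (F m l) by exact: measurable_path.
have PF m l : ((1 - m.+1%:R^-1)%:E <= P (F m l))%E.
  rewrite -[leRHS]fineK ?fin_num_measure// lee_fin.
  have cvgF := @probability_itinerary_cvg (W m l) (N m l).
  rewrite -(cvg_lim _ cvgF)//; apply: limr_ge; last exact: tight.
  by apply/cvg_ex; exists (fine (P (F m l))).
have mlim m : measurable (lim_sup_set (F m)).
  apply: bigcap_measurable => // j _.
  by apply: bigcup_measurable.
(* Fatou for sets: each tail union has mass at least that of one [F m l], and the tail unions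
   decrease to the limsup. *)
have Plim m : ((1 - m.+1%:R^-1)%:E <= P (lim_sup_set (F m)))%E.
  have cvgU := @lim_sup_set_cvg _ _ _ P (F m) (mF m)
    (le_lt_trans (probability_le1 P (bigcup_measurable (fun k _ => mF m k))) (ltry 1)).
  rewrite -(cvg_lim _ cvgU)//; apply: lime_ge.
    by apply/cvg_ex; exists (P (lim_sup_set (F m))).
  apply: nearW => l; apply: le_trans (PF m l) _.
  apply: le_measure; rewrite ?inE//; last by move=> t Ft; exists l => //=.
  by apply: bigcup_measurable.
exists (\bigcup_m lim_sup_set (F m)).
have mG : measurable (\bigcup_m lim_sup_set (F m)) by apply: bigcup_measurable.
split=> //.
  (* The union contains every limsup, so its mass is at least 1 - 1/(m+1) for all [m]. *)
  apply/eqP; rewrite eq_le probability_le1//=.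
  apply/lee_addgt0Pr => e e0.
  have [m _ /(_ m (leqnn m)) /= me] := near_infty_natSinv_lt (PosNum e0).
  rewrite -leeBlDr// -EFinB; apply: le_trans (_ : _ <= P (lim_sup_set (F m)))%E _.
    by apply: le_trans (Plim m); rewrite lee_fin lerD2l lerN2 ltW.
  by apply: le_measure; rewrite ?inE// => t Ft; exists m.
move=> t [m _ Ft].
apply: (complete_subspace_shrinking (complA m)).
- exact: cell_path_neq0.
- by move=> i j; exact: cell_path_mono.
move=> e e0; have [L _ /(_ L (leqnn L)) /= Le] := near_infty_natSinv_lt (PosNum e0).
(* Membership in infinitely many [F m l] supplies some [l >= L], whose radius is below [e]. *)
have [l /= Ll [q Aq cq]] := Ft L I.
exists (N m l), q => //; apply: (subset_trans cq) => y.
apply: le_ball; apply: le_trans (ltW Le).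
by rewrite lef_pV2 ?posrE// ler_nat.
Qed.

Context (G : set Omega) (lim : Omega -> X).
Hypothesis mG : measurable G.
Hypothesis PG : P G = 1%E.
Hypothesis limP : forall t, G t -> forall e, 0 < e ->
  exists k, cell B (path t k) `<=` ball (lim t) e.
Hypothesis limNG : forall t, ~ G t -> lim t = point.

(** On [G], the limit lies in an open [U] exactly when some cell of the branch stays at least
    1/(j+1) inside [U] for some [j]; for given [j] and depth this is a condition on finitely many
    digits. Off [G] the limit is constant. *)
Lemma measurable_lim : measurable_fun setT (lim : Omega -> borel X).
Proof.
apply: (@measurability _ _ Omega (borel X) _ _ (@open X) erefl) => _ [U oU <-].
rewrite setTI.
pose V j : set X := [set x | ball x j.+1%:R^-1 `<=` U].
rewrite (_ : _ @^-1` _ =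
    (G `&` \bigcup_j \bigcup_k [set t | cell B (path t k) `<=` V j])
    `|` (~` G `&` [set t | U point])).
  apply: measurableU; apply: measurableI => //.
  - apply: bigcup_measurable => j _; apply: bigcup_measurable => k _.
    exact: (measurable_path k [set s | cell B s `<=` V j]).
  - exact: measurableC.
  - by case: (pselect (U point)) => H;
      [rewrite (_ : [set _ | _] = setT)|rewrite (_ : [set _ | _] = set0)];
      rewrite ?predeqE//; apply/seteqP; split.
have small e : 0 < e -> exists j, (j.+1%:R^-1 : R) < e.
  move=> e0; have [j _ /(_ j (leqnn j))] := near_infty_natSinv_lt (PosNum e0).
  by exists j.
apply/seteqP; split=> t /=.
  move=> Ut; have [Gt|NGt] := pselect (G t); last by right; rewrite -(limNG NGt).
  left; split=> //.
  have /nbhs_ballP[e /= e0 eU] : nbhs (lim t) U by exact: open_nbhs_nbhs.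
  have [j je] := small _ (divr_gt0 e0 (ltr0Sn _ 1)).
  have [k ck] := limP Gt (divr_gt0 e0 (ltr0Sn _ 1)).
  exists j => //; exists k => //= y /ck ty z yz; apply: eU.
  rewrite (splitr e); apply: ball_triangle ty _.
  by apply: le_ball yz; exact: ltW.
move=> [[Gt [j _ [k _ /= cV]]]|[NGt Up]]; last by rewrite limNG.
have [k' ck'] : exists k', cell B (path t k') `<=` ball (lim t) j.+1%:R^-1.
  by apply: limP => //; rewrite invr_gt0.
(* A point of the deeper cell is in [V j] and within the same radius of [lim t], which puts [lim t]
   in [U]. *)
have [y cy] := cell_path_neq0 t (maxn k k').
apply: (cV y (cell_path_mono (leq_maxl _ _) cy)).
by apply/ball_sym/ck'/(cell_path_mono (leq_maxr k k')).
Qed.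

(* The infimum of [f] over the cells bounds [f] from below, depends on finitely
   many digits, and tends to [f (lim t)] along a branch [t]; hence no uniform
   continuity of [f] is needed. *)
Let inff (f : X -> R) s := inf (f @` cell B s).

Lemma Rintegral_lim_lower (f : X -> R) (M e : R) :
  continuous f -> (forall x, `|f x| <= M) -> 0 < e ->
  \forall n \near \oo, \int[P]_t f (lim t) - e < \int[mu n]_x f x.
Proof.
move=> cf fM e0.
have lbf s : has_lbound (f @` cell B s).
  by exists (- M) => _ [x _ <-]; have := fM x; rewrite ler_norml => /andP[].
have inffE s x : cell B s x -> inff f s <= f x.
  by move=> sx; apply: ge_inf => //; exists x.
have inff_ge s a : cell B s !=set0 -> (forall x, cell B s x -> a <= f x) ->
    a <= inff f s.
  move=> [x sx] af; apply: lb_le_inf; first by exists (f x), x.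
  by move=> _ [y sy <-]; exact: af.
have inffM s : cell B s !=set0 -> `|inff f s| <= M.
  move=> s0; have [x sx] := s0; rewrite ler_norml inff_ge//=.
    by apply: (le_trans (inffE _ _ sx)); have := fM x; rewrite ler_norml => /andP[].
  by move=> y _; have := fM y; rewrite ler_norml => /andP[].
have mf := continuous_measurable_borel cf.
have cvgk : \int[P]_t inff f (path t k) @[k --> \oo] --> \int[P]_t f (lim t).
  apply: (@Rintegral_bounded_cvg _ _ _ _ _ _ M).
  - by move=> k; exact: (measurable_countable_comp (measurable_fiber_path k)).
  - exact: measurableT_comp mf measurable_lim.
  - by move=> k t; exact/inffM/cell_path_neq0.
  exists (~` G); split; first exact: measurableC.
    by rewrite probability_setC// PG subee.
  move=> t /= + Gt; apply; apply/cvgrPdist_le => eps eps0.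
  have /cvgr_dist_le/(_ _ eps0) : f x @[x --> lim t] --> f (lim t) by exact: cf.
  move=> /nbhs_ballP[r /= r0 rP]; have [k0 ck0] := limP Gt r0.
  exists k0 => // k /= k0k; have sub := subset_trans (cell_path_mono k0k) ck0.
  have fE y : cell B (path t k) y -> f (lim t) - eps <= f y <= f (lim t) + eps.
    by move=> /sub/rP; rewrite /= distrC ler_distl.
  have [y cy] := cell_path_neq0 t k.
  rewrite distrC ler_distl inff_ge//=; [|by exists y|by move=> z /fE/andP[]].
  by rewrite (le_trans (inffE _ _ cy))//; have /andP[] := fE _ cy.
have e20 : 0 < e / 2 by rewrite divr_gt0.
(* The depth [k] is fixed first, at a cost of [e / 2]; the other half pays for the passage to large
   [n] at that depth. *)
have /cvgrPdist_lt/(_ _ e20)[k _ /(_ k (leqnn k)) /= kP] := cvgk.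
have /cvgrPdist_lt/(_ _ e20) := @Rintegral_itinerary_cvg (inff f) k.
apply: filterS => n /= nP.
have : \int[mu n]_x inff f (itinerary B x k) <= \int[mu n]_x f x.
  apply: le_Rintegral => //.
  - apply: (@bounded_integrable _ _ _ (mu n) _ M).
      exact: (measurable_countable_comp (measurable_fiber_itinerary mB k)).
    by move=> x; apply: inffM; exists x; exact: cell_itinerary.
  - exact: (bounded_integrable (mu n) mf fM).
  - by move=> x _; apply: inffE; exact: cell_itinerary.
by move: kP nP; rewrite !ltr_distl => /andP[_ kP] /andP[_ nP]; lra.
Qed.

(** The limit is the law of [lim]; the lower bound applied to [f] and to [- f] encloses the
    integrals from both sides. *)
Lemma weakly_converges_lim :
  exists nu : probability (borel X) R, weakly_converges mu nu.
Proof.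
pose T : {mfun Omega >-> borel X} := mfun_Sub (mem_set measurable_lim).
pose nu : probability (borel X) R := distribution P T.
exists nu => f cf [M [_ Mf]].
(* [bounded_fun] bounds the absolute value of [f] by every number above [M], hence the [M + 1]. *)
have fM x : `|f x| <= M + 1 by apply: (Mf (M + 1)) => //; rewrite ltrDl.
have mf := continuous_measurable_borel cf.
have iflim : P.-integrable setT (EFin \o (f \o lim)).
  apply: (@bounded_integrable _ _ _ P _ (M + 1)).
    exact: measurableT_comp mf measurable_lim.
  by move=> t; exact: fM.
have nuE : \int[nu]_x f x = \int[P]_t f (lim t).
  congr fine; apply: (@integral_distribution _ _ _ _ _ P T (EFin \o f)) => //.
  exact/measurable_EFinP.
rewrite nuE; apply/cvgrPdist_lt => e e0.
have cNf : continuous (fun x => - f x) by move=> x; apply: cvgN; exact: cf.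
have fNM x : `|- f x| <= M + 1 by rewrite normrN.
have RN d' (T' : measurableType d') (rho : probability T' R) (g : T' -> R) :
    rho.-integrable setT (EFin \o g) -> \int[rho]_x - g x = - \int[rho]_x g x.
  move=> ig; under eq_Rintegral do rewrite -mulN1r.
  by rewrite RintegralZl// mulN1r.
apply: filterS2 (Rintegral_lim_lower cf fM e0)
  (Rintegral_lim_lower cNf fNM e0) => n.
rewrite !RN//; last exact: (bounded_integrable (mu n) mf fM).
by rewrite ltr_distl => ? ?; apply/andP; split; lra.
Qed.

End limit_law.

(** * Finite covers, the choice of balls and the extraction of the limit *)

Lemma open_metric_ball (R : realType) (X : pointedMetricType R) (x : X) (e : R) :
  open (ball x e).
Proof.
rewrite openE => y; rewrite /interior ballEmdist /= => xy.
apply/nbhs_ballP; exists (e - mdist x y) => /=; first by rewrite subr_gt0.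
move=> z; rewrite ballEmdist /= => yz.
by rewrite (le_lt_trans (metric_triangle _ y _))// -ltrBrDl.
Qed.

Lemma near_increasing (f : nat -> nat) (Q : nat -> Prop) :
  increasing_seq f -> (\forall n \near \oo, Q n) ->
  \forall n \near \oo, Q (f n).
Proof.
move=> incf [N _ NQ]; exists N => // n /= Nn; apply: NQ => /=.
apply: leq_trans Nn _; elim: n => // n IH.
by apply: leq_ltn_trans IH _; move/increasing_seqP : incf; exact.
Qed.

(** Finitely many balls of radius [e / 2] cover [K]; doubling their radius absorbs the
    neighbourhood. *)
Lemma compact_neighborhood_cover (R : realType) (X : pointedMetricType R)
    (K : set X) (e : R) : compact K -> 0 < e ->
  exists Q : seq X, [set` Q] `<=` K /\
    neighborhood K (e / 2) `<=` \bigcup_(q in [set` Q]) ball q e.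
Proof.
rewrite compact_cover => cK e0; have e20 : 0 < e / 2 by rewrite divr_gt0.
have [||Q QK KQ] := cK X K (fun q => ball q (e / 2)).
- by move=> q _; exact: open_metric_ball.
- by move=> x Kx; exists x => //; exact: ballxx.
exists (finmap.enum_fset Q); split; first by move=> q /QK; rewrite inE.
move=> y [x Kx xy]; have [q Qq qx] := KQ x Kx.
by exists q => //; rewrite (splitr e); exact: ball_triangle xy.
Qed.

(** The liminf is the supremum of the tail infima, so the strict gap makes one of them exceed
    [a]. *)
Lemma limn_einf_near (R : realType) (u : nat -> \bar R) (a b : \bar R) :
  (a < b)%E -> (b <= limn_einf u)%E -> \forall n \near \oo, (a <= u n)%E.
Proof.
move=> ab; rewrite limn_einf_lim (cvg_lim _ (@cvg_einfs_sup _ u))// => bu.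
have /ereal_sup_gt[_ [N _ <-] aN] := lt_le_trans ab bu.
exists N => // n /= Nn; apply: le_trans (ltW aN) _.
by apply: ereal_inf_lbound; exists n.
Qed.

Theorem theorem1p2 (R : realType) (X : pointedMetricType R)
    (mu : nat -> probability (borel X) R) :
  sequentially_tight mu -> precompact_seq mu.
Proof.
move=> tight phi incphi.
have mopen (U : set X) : open U -> measurable (U : set (borel X)).
  exact: sub_sigma_algebra.
(* The value 1/(m+2) leaves a strict gap to the 1/(m+1) in [good_event]. *)
have /choice[K /all_and3[cK tK complK]] : forall m : nat,
    exists K : R -> set X, [/\ forall e, 0 < e -> compact (K e),
      forall e, 0 < e ->
        ((1 - m.+2%:R^-1)%:E <= limn_einf (fun n => mu n (neighborhood (K e) e)))%E
      & complete_subspace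
          (closure (\bigcup_(e in [set e | 0 < e]) K e))].
  by move=> m; apply: tight; rewrite invr_gt0.
pose r l : R := l.+1%:R^-1.
have r0 l : 0 < r l by rewrite invr_gt0.
pose A m := \bigcup_(e in [set e | 0 < e]) K m e.
have /choice[Q QP] : forall ml : nat * nat, exists Q : seq X,
    [set` Q] `<=` K ml.1 (r ml.2 / 2) /\
    neighborhood (K ml.1 (r ml.2 / 2)) (r ml.2 / 2)
      `<=` \bigcup_(q in [set` Q]) ball q (r ml.2).
  move=> [m l]; apply: compact_neighborhood_cover => //.
  by apply: cK; rewrite divr_gt0.
(* A code of no triple gives the empty set, and an [i] past the end of [Q (m, l)] gives a ball at
   [point]: harmless extra open sets in the enumeration. *)
pose B j : set X := if unpickle j is Some (m, l, i) then
  ball (nth point (Q (m, l)) i) (r l) else set0.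
have oB j : open (B j).
  rewrite /B; case: (unpickle j) => [[[m l] i]|]; last exact: open0.
  exact: open_metric_ball.
have mB j : measurable (B j : set (borel X)) by exact: mopen.
have mcell := measurable_cell mB.
have [|psi incpsi [p pP]] := @diagonal_subsequence R (seq bool)
    (fun n s => fine (mu (phi n) (cell B s))).
  move=> n s; rewrite fine_ge0//= -lee_fin fineK ?fin_num_measure//.
  exact: probability_le1.
exists psi; split=> //; set nu := fun n => mu (phi (psi n)).
have p0 s : 0 <= p s.
  rewrite -(cvg_lim _ (@pP s))//; apply: limr_ge.
    by apply/cvg_ex; exists (p s).
  by apply: nearW => n; rewrite fine_ge0.
have p1 : p [::] = 1.
  rewrite -(cvg_lim _ (@pP [::]))// (_ : cell B [::] = setT); last exact/seteqP.
  under eq_fun do rewrite probability_setT.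
  exact: lim_cst.
have pD s : p s = p (false :: s) + p (true :: s).
  rewrite -(cvg_lim _ (@pP s))//.
  under eq_fun do rewrite (probability_cell_split mB) fineD ?fin_num_measure//.
  by apply/cvg_lim => //; apply: cvgD.
have [d0 [Y [P [path [path0 pathS p_path Ppath]]]]] :=
  tree_probability p0 p1 pD.
have mpath s : measurable [set t | path t (size s) = s] by case: (Ppath s).
have PP s : P [set t | path t (size s) = s] = (p s)%:E by case: (Ppath s).
(* [N m l] exceeds the code of every ball chosen for [(m, l)], so itineraries of that length decide
   membership in all of them. *)
pose N m l := (\max_(i < size (Q (m, l))) pickle (m, l, val i)).+1.
(* The centres range over a possibly uncountable [A m]; the event is measurable because it depends
   on the itinerary only. *)
have mW m l := measurable_countable_preimage
  (measurable_fiber_itinerary mB (N m l))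
  [set s | exists2 q, A m q & cell B s `<=` ball q (r l)].
have [||G [mG PG GP]] := @good_event R X B oB nu p pP d0 Y P path path0 pathS
    p_path mpath PP A N.
- exact: complK.
- move=> m l; have r20 : 0 < r l / 2 by rewrite divr_gt0.
  have := limn_einf_near _ (tK m _ r20).
  move=> /(_ (1 - m.+1%:R^-1)%:E); rewrite lte_fin ltrD2l ltrN2.
  rewrite ltf_pV2 ?posrE// ltr_nat => /(_ (ltnSn _)).
  move=> /(near_increasing incphi)/(near_increasing incpsi).
  apply: filterS => n; rewrite -lee_fin fineK ?fin_num_measure//; last first.
    exact: mW.
  move=> /le_trans; apply; apply: le_measure; rewrite ?inE.
  + apply: mopen; apply: bigcup_open => x _; exact: open_metric_ball.
  + exact: mW.
  have [QK KQ] := QP (m, l).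
  move=> x /KQ[q /= Qq qx]; exists q; first by exists (r l / 2) => //; exact: QK.
  (* The chosen ball is some [B j] with [j < N m l], so it contains the whole cell of [x]. *)
  have qE : ball q (r l) = B (pickle (m, l, index q (Q (m, l)))).
    by rewrite /B pickleK nth_index.
  rewrite qE; apply: (@cell_itinerary_sub X B x (N m l)); last by rewrite -qE.
  have iQ : (index q (Q (m, l)) < size (Q (m, l)))%N by rewrite index_mem.
  rewrite ltnS; exact: (leq_bigmax
    (F := fun i : 'I_(size (Q (m, l))) => pickle (m, l, val i)) (Ordinal iQ)).
have /choice[lim limP] : forall t, exists x,
    (G t -> forall e, 0 < e -> exists k, cell B (path t k) `<=` ball x e) /\
    (~ G t -> x = point).
  move=> t; have [Gt|NGt] := pselect (G t); last by exists point.
  by have [x xP] := GP t Gt; exists x.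
exact: (@weakly_converges_lim R X B oB nu p pP d0 Y P path path0 pathS p_path
  mpath PP G lim mG PG (fun t => (limP t).1) (fun t => (limP t).2)).
Qed.
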